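(* Let $H$ be a hypergraph and let $v$ be a vertex of $H$ that is not isolated and not contained in any induced Berge cycle of length $3$. Let $e_1, \ldots, e_k$ be the edges of $H$ containing $v$ and $\tilde{e}_i = e_i \setminus \{v\}$. Let $K = \mathrm{st}(v) \cap \bigcup_{i=1}^k \mathrm{st}(\tilde{e}_i)$ (stars taken in $I(H)$), regarded as a complex on $V(H) \setminus \{v\}$, and let $H_v$ be the set of missing faces of $K$, i.e. the inclusion-minimal subsets of $V(H)\setminus\{v\}$ not belonging to $K$. Then $\tilde{e}_1, \ldots, \tilde{e}_k \in H_v$. Moreover, for a set $f$, we have $f \in H_v \setminus \{\tilde{e}_1, \ldots, \tilde{e}_k\}$ if and only if $\tilde{e}_i \not\subseteq f$ for all $i \in \{1,\ldots,k\}$ and the following hold: (i) for each $i \in \{1,\ldots,k\}$ there is an edge $h_i \in H \setminus \{e_1, \ldots, e_k\}$ with $h_i \subseteq f \cup e_i$; and (ii) $f$ is inclusion-minimal subject to (i).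
   Context: A hypergraph $H$ on a finite set $V=V(H)$ is a collection of nonempty subsets of $V$, called edges. Standing convention: every edge of $H$ is inclusion-minimal (no edge properly contains another edge) and has size at least $2$. An independent set of $H$ is a subset of $V(H)$ containing no edge of $H$; the independence complex $I(H)$ is the simplicial complex of all independent sets. A vertex is isolated if it lies in no edge. A Berge cycle of length $k$ in $H$ is an alternating sequence $v_1 e_1 \cdots v_k e_k$ of $k$ distinct vertices and $k$ distinct edges with $v_i, v_{i+1} \in e_i$ (indices mod $k$); it is induced if $e_i \cap \{v_1,\ldots,v_k\} = \{v_i,v_{i+1}\}$ for all $i$ and no edge contains two non-consecutive vertices of the cycle. For a simplicial complex $X$ on $V$ and $\sigma \in X$, $\mathrm{st}_X(\sigma) = \{\tau \subseteq V : \tau \cup \sigma \in X\}$. *)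

(* Defs.v *)
From mathcomp Require Import all_boot.
Set Implicit Arguments.
Unset Strict Implicit.
Unset Printing Implicit Defensive.

(* A hypergraph whose vertex set is the finite type V is given
   by its set of edges H : {set {set V}}. *)
Section Hypergraphs.

Variable V : finType.
Implicit Types (H X K : {set {set V}}) (A B W s t : {set V}) (v : V).

Definition hypergraph H : Prop :=
  (forall A, A \in H -> 2 <= #|A|) /\
  (forall A B, A \in H -> B \in H -> ~~ (A \proper B)).

Definition independent H A : bool := [forall (B | B \in H), ~~ (B \subset A)].

Definition indep_complex H : {set {set V}} := [set A | independent H A].

Definition isolated H v : bool := [forall (A | A \in H), v \notin A].

(* [ordS] is the cyclic successor on 'I_k, so indices are taken mod k. *)
Definition berge_cycle H k (vs : 'I_k -> V) (es : 'I_k -> {set V}) : Prop :=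
  [/\ injective vs, injective es, forall i, es i \in H &
      forall i, vs i \in es i /\ vs (ordS i) \in es i].

Definition induced_berge_cycle H k (vs : 'I_k -> V) (es : 'I_k -> {set V})
    : Prop :=
  [/\ berge_cycle H vs es,
      forall i, es i :&: [set vs j | j : 'I_k] = [set vs i; vs (ordS i)] &
      forall i j, j != i -> j != ordS i -> i != ordS j ->
      forall A, A \in H -> ~~ ((vs i \in A) && (vs j \in A))].

(* Only meaningful for s \in X. *)
Definition star X s : {set {set V}} := [set t | t :|: s \in X].

(* Missing faces of K regarded as a complex on the vertex set W. *)
Definition missing_faces W K : {set {set V}} :=
  [set A | minset (fun B => (B \subset W) && (B \notin K)) A].

End Hypergraphs.

(* Main.v *)
(* For f avoiding v, an edge contained in v |: f is either contained in f, hence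
   in f :|: e i for every i, or is some e i, and then et i is contained in f.
   So f is a non-face of K iff it contains some et i or satisfies (i), and since
   the et i are minimal non-faces, the remaining minimal non-faces are exactly
   the minimal sets satisfying (i) that contain no et i. *)
Require Import Defs.
From mathcomp Require Import all_boot.

Lemma dependentP (V : finType) (H : {set {set V}}) (A : {set V}) :
  reflect (exists2 B, B \in H & B \subset A) (~~ independent H A).
Proof.
rewrite negb_forall_in.
by apply: (iffP exists_inP) => -[B HB]; rewrite ?negbK => sBA;
   exists B => //; rewrite negbK.
Qed.

Theorem theorem4p1 (V : finType) (H : {set {set V}}) (v : V)
  (hypH : hypergraph H)
  (not_isolated : ~~ isolated H v)
  (no_triangle : forall (vs : 'I_3 -> V) (es : 'I_3 -> {set V}),
     induced_berge_cycle H vs es -> forall i : 'I_3, vs i <> v)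
  (k : nat) (e : 'I_k -> {set V})
  (e_inj : injective e)
  (e_edges : [set e i | i : 'I_k] = [set A in H | v \in A]) :
  let et := fun i : 'I_k => e i :\ v in
  let K := star (indep_complex H) [set v]
           :&: \bigcup_(i < k) star (indep_complex H) (et i) in
  let Hv := missing_faces [set~ v] K in
  let cond_i := fun f : {set V} =>
    [forall i : 'I_k,
      [exists (h | h \in H :\: [set e j | j : 'I_k]), h \subset f :|: e i]] in
  (forall i : 'I_k, et i \in Hv) /\
  (forall f : {set V},
     f \in Hv :\: [set et i | i : 'I_k] <->
     [/\ forall i : 'I_k, ~~ (et i \subset f), cond_i f & minset cond_i f]).
Proof.
move=> et K Hv cond_i; have [_ antichain] := hypH.
have in_e h : (h \in [set e j | j : 'I_k]) = (h \in H) && (v \in h).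
  by rewrite e_edges inE.
have eP i : e i \in H /\ v \in e i by apply/andP; rewrite -in_e imset_f.
have eE i : e i = v |: et i by rewrite setD1K //; case: (eP i).
have v_et i : v \notin et i by rewrite !inE eqxx.
(* Adding [v] back would turn a strict inclusion into one between edges. *)
have et_incomparable i j : ~~ (et j \proper et i).
  apply: contra (antichain _ _ (proj1 (eP j)) (proj1 (eP i))) => /properP[sji].
  case=> x xi xj; rewrite !eE; apply/properP; split; first exact: setUS.
  exists x; rewrite in_setU1 ?xi ?orbT // (negPf xj) orbF.
  by apply: contraNneq (v_et i) => <-.
(* An edge outside the [e j] avoids [v], so in (i) it fits in [f :|: e i] exactly when it fits in
   [f :|: et i]. *)
have condP f : reflect
    (forall i, exists h, [/\ h \in H, v \notin h & h \subset f :|: et i])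
    (cond_i f).
  apply: (iffP forallP) => C i.
    have /exists_inP[h] := C i; rewrite inE in_e => /andP[nh Hh] sh.
    move: nh; rewrite Hh /= => nvh; exists h; split=> //.
    apply/subsetP=> x xh; have := subsetP sh x xh.
    rewrite eE !inE; case: eqP => //= xv.
    by rewrite -xv xh in nvh.
  have [h [Hh nvh sh]] := C i; apply/exists_inP; exists h.
    by rewrite inE in_e Hh nvh.
  by rewrite (subset_trans sh) // setUS // eE subsetUr.
have nonfaceP (f : {set V}) : v \notin f ->
    (f \notin K) = [exists i, et i \subset f] || cond_i f.
  move=> nvf; rewrite inE negb_and; apply/idP/idP; last first.
    case/orP=> [/existsP[i sif]|/condP C]; apply/orP; [left|right].
      rewrite !inE; apply/dependentP; exists (e i); first by case: (eP i).
      by rewrite eE setUC setSU.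
    apply/bigcupP=> -[i _]; rewrite !inE; apply/negP/dependentP.
    by have [h [Hh _ sh]] := C i; exists h.
  case/orP=> [|nKf].
    rewrite !inE => /dependentP[h Hh sh]; case vh: (v \in h).
      have: h \in [set e j | j : 'I_k] by rewrite in_e Hh.
      case/imsetP=> i _ hE; apply/orP; left; apply/existsP; exists i.
      by rewrite subDset -hE setUC.
    apply/orP; right; apply/condP=> i; exists h; rewrite vh; split=> //.
    apply/subsetP=> x xh; have := subsetP sh x xh; rewrite !inE.
    by case: eqP => [xv|_]; [rewrite -xv xh in vh | rewrite orbF => ->].
  (* Here [f] lies outside the star of every [et i]. Neither [f] nor [et i] contains [v], so the
     edge found in their union is not among the [e j]. *)
  apply/orP; right; apply/condP=> i.
  have: ~~ independent H (f :|: et i).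
    by apply: contra nKf => If; apply/bigcupP; exists i; rewrite // !inE.
  case/dependentP=> h Hh sh; exists h; split=> //.
  by apply/negP=> /(subsetP sh); rewrite inE (negPf nvf) (negPf (v_et i)).
have avoids (f : {set V}) : (f \subset [set~ v]) = (v \notin f).
  by rewrite -disjoints1 disjoint_sym disjoints_subset.
have HvP (f : {set V}) : reflect
    [/\ v \notin f, [exists i, et i \subset f] || cond_i f &
        forall g : {set V}, v \notin g ->
          [exists i, et i \subset g] || cond_i g -> g \subset f -> g = f]
    (f \in Hv).
  rewrite inE; apply: (iffP minsetP) => [[/andP[]]|[nvf Pf minf]].
    rewrite avoids => nvf; rewrite nonfaceP // => Pf minf; split=> // g nvg Pg.
    by apply: minf; rewrite avoids nvg nonfaceP.
  rewrite avoids nvf nonfaceP //; split=> // g /andP[].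
  by rewrite avoids => nvg; rewrite nonfaceP //; apply: minf.
have et_Hv i : et i \in Hv.
  apply/HvP; split=> //; first by apply/orP; left; apply/existsP; exists i.
  (* If [g] contains some [et j], then [et j] lies in [et i], and incomparability forces [g] to be
     all of [et i]. *)
  move=> g _ /orP[/existsP[j sjg]|/condP/(_ i)[h [Hh nvh sh]]] sgi.
    apply/eqP; rewrite eqEsubset sgi /=.
    apply: contraR (et_incomparable i j) => nsig; rewrite properE.
    rewrite (subset_trans sjg sgi).
    by apply: contra nsig => sij; apply: subset_trans sjg.
  (* If [g] satisfies (i), then [h] lies in [g :|: et i], which is [et i]: an edge properly inside
     [e i], as it misses [v]. *)
  case/negP: (antichain _ _ Hh (proj1 (eP i))); apply/properP; split.
    rewrite (subset_trans sh) // subUset eE subsetUr andbT.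
    by rewrite (subset_trans sgi) ?subsetUr.
  by exists v => //; case: (eP i).
split=> // f; rewrite inE; split.
  case/andP=> net /HvP[nvf Pf minf].
  (* Each [et i] is a non-face, so a minimal non-face containing it would equal it. *)
  have nsub i : ~~ (et i \subset f).
    apply: contra net => sif; apply/imsetP; exists i => //.
    by rewrite -(minf (et i)) //; apply/orP; left; apply/existsP; exists i.
  have Cf : cond_i f.
    by case/orP: Pf => // /existsP[i]; rewrite (negPf (nsub i)).
  split=> //; apply/minsetP; split=> // g Cg sgf.
  apply: minf => //; last by rewrite Cg orbT.
  by apply: contra nvf; apply: (subsetP sgf).
case=> nsub Cf /minsetP[_ minf].
(* The edges [h] witnessing (i) avoid [v], so [f :\ v] still satisfies (i), and minimality gives
   [f :\ v = f]. *)
have nvf : v \notin f.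
  suffices <-: f :\ v = f by rewrite !inE eqxx.
  apply: minf; last exact: subsetDl.
  apply/condP=> i; have [h [Hh nvh sh]] := condP f Cf i; exists h; split=> //.
  apply/subsetP=> x xh; have := subsetP sh x xh; rewrite !inE.
  by case: eqP => // xv; rewrite -xv xh in nvh.
apply/andP; split.
  by apply/imsetP=> -[i _ fE]; move: (nsub i); rewrite fE subxx.
(* A non-face inside [f] contains no [et i], so it satisfies (i) and minimality with respect to (i)
   applies. *)
apply/HvP; rewrite Cf orbT; split=> // g _ /orP[/existsP[i sig]|Cg] sgf.
  by case/negP: (nsub i); apply: subset_trans sgf.
exact: minf.
Qed.
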